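(* Let $M$ be an Orlicz function which satisfies condition $\Delta_{2+}$ and such that $M''$ is a continuous function on $[0,\infty)$ with $M''(0)=0$ and $M''(t)>0$ for all $t>0$. Let $T:L_M\to L_M$ be an isometry (not necessarily surjective). Then $T$ preserves disjointness.
   Context: An Orlicz function is a convex function $M:[0,\infty)\to[0,\infty)$ with $M(0)=0$, $M(1)=1$, $\lim_{u\to0}M(u)/u=0$ and $\lim_{u\to\infty}M(u)/u=\infty$. The Orlicz space $L_M$ is the space of (equivalence classes of) measurable scalar-valued (real or complex) functions $f$ on $[0,1]$ with Lebesgue measure $\mu$ such that $\|f\|_M<\infty$, where $\|f\|_M=\inf\{\lambda>0:\int M(|f|/\lambda)\,d\mu\le 1\}$ (Luxemburg norm). $M$ satisfies the $\Delta_2$ condition if there are $k>0$, $u_0\ge0$ with $M(2u)\le kM(u)$ for all $u\ge u_0$. $M$ satisfies condition $\Delta_{2+}$ if $M$ is twice differentiable, satisfies the $\Delta_2$ condition, and there are constants $\beta>0$ and $u_0\ge 0$ such that $\frac{uM''(u)}{M'(u)}<\beta$ for all $u\ge u_0$. Derivatives at $0$ are one-sided. Isometries are linear norm-preserving maps. $T$ preserves disjointness if, whenever $f,g\in L_M$ satisfy $\mu(\operatorname{supp} f\cap\operatorname{supp} g)=0$, also $\mu(\operatorname{supp} Tf\cap\operatorname{supp} Tg)=0$. *)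

(* Defs.v *)
From mathcomp Require Import all_boot all_order all_algebra.
From mathcomp Require Import all_classical all_reals all_analysis.
From mathcomp Require Import complex.

Set Implicit Arguments.
Unset Strict Implicit.
Unset Printing Implicit Defensive.

Import Order.TTheory GRing.Theory Num.Theory.
Import numFieldNormedType.Exports.

Local Open Scope classical_set_scope.
Local Open Scope ring_scope.

Section OneSidedCalculus.
Context {R : realType}.
Implicit Types (F : R -> R) (u : R).

(* Differentiation on [0, +oo[: the derivative at 0 is the right derivative,
   so the values of F on negative arguments never matter. *)
Definition derivable_nneg F u : Prop :=
  if u == 0 then cvg ((F h - F 0) / h @[h --> 0^'+])
  else derivable F u 1.

Definition derive_nneg F u : R :=
  if u == 0 then lim ((F h - F 0) / h @[h --> 0^'+])
  else derive1 F u.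

End OneSidedCalculus.

Section OrliczFunctions.
Context {R : realType}.
Implicit Types (M : R -> R).

(* M : [0, +oo[ -> [0, +oo[ is represented by any extension to R. *)
Definition orlicz_function M : Prop :=
  [/\ (forall u, 0 <= u -> 0 <= M u),
      convex_function (`[0, +oo[%classic : set R^o) M,
      M 0 = 0 /\ M 1 = 1,
      M u / u @[u --> 0^'+] --> 0 &
      M u / u @[u --> +oo] --> +oo].

Definition Delta2 M : Prop :=
  exists k u0 : R, [/\ 0 < k, 0 <= u0 &
    forall u, u0 <= u -> M (2 * u) <= k * M u].

Definition twice_derivable_nneg M : Prop :=
  forall u, 0 <= u ->
    derivable_nneg M u /\ derivable_nneg (derive_nneg M) u.

(* Division by zero gives 0, so the last bound holds trivially where
   M'(u) = 0; for an Orlicz function this cannot occur for large u. *)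
Definition Delta2plus M : Prop :=
  [/\ twice_derivable_nneg M,
      Delta2 M &
      exists beta u0 : R, [/\ 0 < beta, 0 <= u0 &
        forall u, u0 <= u ->
          u * derive_nneg (derive_nneg M) u / derive_nneg M u < beta]].

End OrliczFunctions.

Variant scalar_kind := RealScalars | ComplexScalars.

Definition scalar_field (R : realType) (k : scalar_kind) : numFieldType :=
  match k with
  | RealScalars => R
  | ComplexScalars => R[i]%C
  end.

Definition modulus (R : realType) (k : scalar_kind) : scalar_field R k -> R :=
  match k return scalar_field R k -> R with
  | RealScalars => fun z : R => `|z|
  | ComplexScalars => fun z : R[i]%C => complex.Re `|z|
  end.

Definition scalar_measurable (R : realType) (k : scalar_kind) (D : set R) :
    (R -> scalar_field R k) -> Prop :=
  match k return (R -> scalar_field R k) -> Prop with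
  | RealScalars => fun f : R -> R => measurable_fun D f
  | ComplexScalars => fun f : R -> R[i]%C =>
      measurable_fun D (fun x => complex.Re (f x)) /\
      measurable_fun D (fun x => complex.Im (f x))
  end.

Section OrliczSpaces.
Context {R : realType} {k : scalar_kind}.
Local Notation K := (scalar_field R k).
Local Notation mu := (@lebesgue_measure R).
Local Notation I01 := (`[0, 1]%classic : set R).
Implicit Types (M : R -> R) (f g : R -> K) (T : (R -> K) -> (R -> K)).

(* Only the restriction of f to [0, 1] matters.  The infimum is +oo when no
   l is admissible. *)
Definition luxemburg_norm M f : \bar R :=
  ereal_inf [set l%:E | l in [set l : R | 0 < l /\
    (\int[mu]_(x in I01) (M (modulus (f x) / l))%:E <= 1)%E]].

Definition orlicz_space M : set (R -> K) :=
  [set f | scalar_measurable I01 f /\ (luxemburg_norm M f < +oo)%E].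

(* The elements of L_M are classes modulo a.e. equality on [0, 1].  A map
   L_M -> L_M is given by its action on representatives, compatible with a.e.
   equality, and identities between values of T are a.e. identities. *)
Definition orlicz_isometry M T : Prop :=
  [/\ (forall f, orlicz_space M f -> orlicz_space M (T f)),
      (forall f g, orlicz_space M f -> orlicz_space M g ->
         ae_eq mu I01 f g -> ae_eq mu I01 (T f) (T g)),
      (forall f g, orlicz_space M f -> orlicz_space M g ->
         ae_eq mu I01 (T (fun x => f x + g x)) (fun x => T f x + T g x)),
      (forall (a : K) f, orlicz_space M f ->
         ae_eq mu I01 (T (fun x => a * f x)) (fun x => a * T f x)) &
      (forall f, orlicz_space M f ->
         luxemburg_norm M (T f) = luxemburg_norm M f)].

Definition supp f : set R := [set x | I01 x /\ f x != 0].

Definition preserves_disjointness M T : Prop :=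
  forall f g, orlicz_space M f -> orlicz_space M g ->
    mu (supp f `&` supp g) = 0%E -> mu (supp (T f) `&` supp (T g)) = 0%E.

End OrliczSpaces.

(* Main.v *)
Require Import Defs.
From mathcomp Require Import all_boot all_order all_algebra.
From mathcomp Require Import all_classical all_reals all_analysis.
From mathcomp Require Import measurable_realfun.
From mathcomp Require Import complex ring lra.

(** Let f and g be disjoint with g bounded by B, and normalize the norm of f to
    be 1 (if it is 0, then T f = 0).  By disjointness the integral of
    M(|f + c g| / l) splits, and the norm of f + c g is at most
    1 + M(|c| B) = 1 + o(|c|^2), since M(0) = M'(0) = M''(0) = 0
    ([norm_disjoint_perturbation], [orlicz_littleo_sqr]).

    Let F = T f and G = T g, and suppose that their supports meet in a set of
    positive measure.  Then |F| and |G| are bounded above and away from 0 on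
    some set E of positive measure.  Everywhere M(|F + c G|) + M(|F - c G|) is at
    least 2 M(|F|).  On E the positivity and continuity of M'' improve this by a
    multiple of |c|^2: M - m u^2 / 2 is still convex and nondecreasing on a
    compact subinterval of ]0, +oo[ for small m, and by the parallelogram
    identity the quadratic term contributes m |c|^2 |G|^2
    ([orlicz_midpoint_curved]).  The Delta_2 condition compares the integral of
    M(|F| / l) with that of M(|F|), which is 1, up to a multiple of l - 1.
    Hence the larger of the norms of F + c G and F - c G is at least
    1 + a |c|^2 with a > 0 ([curvature_estimate]).  As T is an isometry, this
    contradicts the upper bound for small c ([disjoint_of_bounded]).

    For unbounded g, the Delta_2 condition makes the truncations of g converge
    in norm, and disjointness from T f passes to the limit
    ([disjoint_of_pointwise]).  No differentiability of the norm is needed. *)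

Set Implicit Arguments.
Unset Strict Implicit.
Unset Printing Implicit Defensive.

Import Order.TTheory GRing.Theory Num.Theory.
Import numFieldNormedType.Exports.

Local Open Scope classical_set_scope.
Local Open Scope ring_scope.

(** * Orlicz functions: convexity *)

Section Convexity.
Context {R : realType} {M : R -> R}.
Hypothesis hM : orlicz_function M.

Lemma orlicz_ge0 (u : R) : 0 <= u -> 0 <= M u.
Proof. by case: hM => + _ _ _ _; exact. Qed.

Lemma orlicz0 : M 0 = 0.
Proof. by case: hM => _ _ []. Qed.

Lemma orlicz_conv (x y t : R) : 0 <= x -> 0 <= y -> 0 <= t -> t <= 1 ->
  M (t * x + (1 - t) * y) <= t * M x + (1 - t) * M y.
Proof.
move=> x0 y0 t0 t1; case: hM => _ + _ _ _.
move=> /(_ (Itv01 t0 t1) x y); apply; rewrite inE /= in_itv /= andbT //.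
Qed.

Lemma orlicz_scale (t u : R) : 0 <= t -> t <= 1 -> 0 <= u -> M (t * u) <= t * M u.
Proof.
move=> t0 t1 u0; have := @orlicz_conv u 0 t u0 (lexx 0) t0 t1.
by rewrite orlicz0 !mulr0 !addr0.
Qed.

Lemma orlicz_le (u v : R) : 0 <= u -> u <= v -> M u <= M v.
Proof.
move=> u0 uv; have [v0|v0] := eqVneq v 0.
  by have -> : u = v by lra.
have vp : 0 < v by lra.
have t1 : u / v <= 1 by rewrite ler_pdivrMr ?mul1r.
have t0 : 0 <= u / v by rewrite divr_ge0 // ltW.
have := @orlicz_scale (u / v) v t0 t1 (ltW vp).
rewrite divfK // => h; apply: le_trans h _.
by rewrite ler_piMl // orlicz_ge0 // ltW.
Qed.

Lemma orlicz_ge_id (u : R) : 1 <= u -> u <= M u.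
Proof.
move=> u1; have up : 0 < u by lra.
have iu1 : u^-1 <= 1 by rewrite invf_le1.
have := @orlicz_scale u^-1 u _ iu1 (ltW up).
rewrite mulVf ?gt_eqF // invr_ge0 (ltW up) => /(_ isT).
case: hM => _ _ [_ ->] _ _.
by rewrite mulrC ler_pdivlMr // mul1r.
Qed.

(** The point u lies between u / t and 2 u, and the weight of 2 u in this convex
    combination is at most t - 1.  Integrated, this controls how fast the
    modular varies with the scale. *)
Lemma orlicz_dilation (t u : R) : 1 <= t -> 0 <= u ->
  M u <= M (u / t) + (t - 1) * M (2 * u).
Proof.
move=> t1 u0; have tp : 0 < t by lra.
pose s := (t - 1) / (2 * t - 1).
have s0 : 0 <= s by rewrite /s divr_ge0 //; lra.
have s1 : s <= 1 by rewrite /s ler_pdivrMr; lra.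
have st : s <= t - 1 by rewrite /s ler_pdivrMr; [nra|lra].
have ut0 : 0 <= u / t by rewrite divr_ge0 // ltW.
have u20 : 0 <= 2 * u by lra.
have := @orlicz_conv (2 * u) (u / t) s u20 ut0 s0 s1.
have -> : s * (2 * u) + (1 - s) * (u / t) = u.
  by rewrite /s; field; apply/andP; split; rewrite gt_eqF //; lra.
have := orlicz_ge0 u20; have := orlicz_ge0 ut0; nra.
Qed.

Lemma orlicz_measurable (D : set R) (h : R -> R) : measurable D ->
  measurable_fun D h -> (forall x, D x -> 0 <= h x) ->
  measurable_fun D (fun x => M (h x)).
Proof.
move=> mD mh h0.
apply: (@eq_measurable_fun _ _ _ _ _ ((fun u => M (Num.max 0 u)) \o h)).
  by move=> x /set_mem Dx /=; rewrite max_r // h0.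
apply: measurableT_comp => //; apply: nondecreasing_measurable => // u v uv.
apply: orlicz_le; first by rewrite le_max lexx.
by rewrite ge_max !le_max lexx uv orbT.
Qed.

End Convexity.

(** * Orlicz functions: the Delta_2 condition *)

Section GrowthAtInfinity.
Context {R : realType} {M : R -> R}.
Hypothesis hM : orlicz_function M.
Hypothesis hD : Delta2 M.

(** The additive constant absorbs the range where the Delta_2 inequality is not
    assumed; no such term would be needed if it held for all u. *)
Lemma Delta2_affine (s : R) : 0 <= s -> exists k c : R, [/\ 0 <= k, 0 <= c &
  forall u, 0 <= u -> M (s * u) <= k * M u + c].
Proof.
move=> s0; have [k [u0 [k0 u00 hk]]] := hD.
have u20 : 0 <= 2 * u0 by lra.
have M0 := orlicz_ge0 hM u20.
have step (u : R) : 0 <= u -> M (2 * u) <= k * M u + M (2 * u0).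
  move=> u_ge0; have [uu0|u0u] := leP u u0.
    rewrite ler_wpDl ?mulr_ge0 ?(orlicz_ge0 hM) ?(ltW k0) //.
    by apply: (orlicz_le hM); lra.
  by rewrite ler_wpDr // hk // ltW.
have pow (j : nat) : exists k c : R, [/\ 0 <= k, 0 <= c &
    forall u, 0 <= u -> M (2 ^+ j * u) <= k * M u + c].
  elim: j => [|j [k' [c' [k'0 c'0 hj]]]].
    by exists 1, 0; split => // u _; rewrite expr0 !mul1r addr0.
  exists (k' * k), (k' * M (2 * u0) + c'); split => [||u uge0].
  - by rewrite mulr_ge0 // ltW.
  - by rewrite addr_ge0 // mulr_ge0.
  - have u2 : 0 <= 2 * u by lra.
    rewrite exprSr -mulrA; apply: (le_trans (hj _ u2)).
    have := step u uge0; nra.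
have sj : s <= 2 ^+ Num.bound `|s|.
  apply: le_trans (ler_norm s) _.
  apply: le_trans (ltW (archi_boundP (normr_ge0 s))) _.
  by rewrite -natrX ler_nat ltnW // ltn_expl.
have [k' [c' [k'0 c'0 hj]]] := pow (Num.bound `|s|).
exists k', c'; split => // u uge0; apply: le_trans (hj _ uge0).
by apply: (orlicz_le hM); [rewrite mulr_ge0|rewrite ler_wpM2r].
Qed.
End GrowthAtInfinity.

(** * Orlicz functions: the second derivative *)

(** A quantitative strict convexity on compact subintervals of ]0, +oo[.  If
    p = |z + w|, q = |z - w|, a = |z| and d = |w|, the last two hypotheses are
    the triangle inequality and the parallelogram identity; the inequality is
    stated on reals so that it serves real and complex scalars alike. *)
Definition midpoint_curved (R : realType) (M : R -> R) : Prop :=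
  forall x y : R, 0 < x -> x < y ->
  exists2 m, 0 < m & forall p q a d : R,
    p \in `[x, y] -> q \in `[x, y] -> a \in `[x, y] ->
    2 * a <= p + q -> p ^+ 2 + q ^+ 2 = 2 * a ^+ 2 + 2 * d ^+ 2 ->
    2 * M a + m * d ^+ 2 <= M p + M q.

Section SecondDerivative.
Context {R : realType} {M : R -> R}.
Hypothesis hM : orlicz_function M.
Hypothesis hM1 : twice_derivable_nneg M.
Hypothesis hM2c : {within `[0, +oo[, continuous (derive_nneg (derive_nneg M))}.
Hypothesis hM20 : derive_nneg (derive_nneg M) 0 = 0.
Hypothesis hM2p : forall t : R, 0 < t -> 0 < derive_nneg (derive_nneg M) t.

Lemma is_derive_nneg (u : R) : 0 < u -> is_derive u 1 M (derive_nneg M u).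
Proof.
move=> u0; have [+ _] := hM1 (ltW u0).
rewrite /derivable_nneg /derive_nneg gt_eqF // => d.
by rewrite derive1E; exact/derivableP.
Qed.

Lemma is_derive2_nneg (u : R) : 0 < u ->
  is_derive u 1 (derive_nneg M) (derive_nneg (derive_nneg M) u).
Proof.
move=> u0; have [_ +] := hM1 (ltW u0).
rewrite /derivable_nneg gt_eqF // => d.
by rewrite {2}/derive_nneg gt_eqF // derive1E; exact/derivableP.
Qed.

Lemma MVT_pos (f df : R -> R) (a b : R) : 0 < a -> a < b ->
  (forall x : R, 0 < x -> is_derive x 1 f (df x)) ->
  exists2 c, c \in `]a, b[ & f b - f a = df c * (b - a).
Proof.
move=> a0 ab fd; apply: MVT => //.
  by move=> x; rewrite in_itv /= => /andP[ax _]; apply: fd; lra.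
apply: continuous_in_subspaceT => x /[!inE] /=; rewrite in_itv /= => /andP[ax _].
have x0 : 0 < x by lra.
by apply: differentiable_continuous; apply/derivable1_diffP; have [] := fd _ x0.
Qed.

Lemma derive_nneg0 : derive_nneg M 0 = 0.
Proof.
rewrite /derive_nneg eqxx; apply: cvg_lim => //.
have := hM => -[_ _ [M0 _] + _].
by under [in X in _ -> X]eq_fun do rewrite M0 subr0.
Qed.

(** Since M'(0) = M''(0) = 0, M'(c) <= e c near 0; the mean value theorem on
    [u / 2, u] avoids the endpoint 0, and the half of M that it misses is
    recovered from M (u / 2) <= M u / 2. *)
Lemma orlicz_littleo_sqr (e : R) : 0 < e ->
  exists2 d, 0 < d & forall u : R, 0 < u -> u < d -> M u <= e * u ^+ 2.
Proof.
move=> e0.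
have [_] := hM1 (lexx 0).
rewrite /derivable_nneg eqxx => /cvg_ex[l hl].
have l0 : l = 0.
  rewrite -hM20; apply/esym; move: hl; rewrite /derive_nneg eqxx => hl.
  exact: cvg_lim.
rewrite l0 in hl.
have := (cvgr0Pnorm_lt _).1 hl e e0; rewrite near_withinE => -[d /= d0 hd].
exists d => // u u0 ud.
have u2 : u / 2 < u by lra.
have [||c] := @MVT_pos M (derive_nneg M) (u / 2) u _ u2.
- by lra.
- exact: is_derive_nneg.
rewrite in_itv /= => /andP[uc cu] hc.
have c0 : 0 < c by lra.
have := hd c.
rewrite /ball /= sub0r normrN gtr0_norm // => /(_ (lt_trans cu ud) c0).
rewrite derive_nneg0 subr0 => hcl.
have dc : derive_nneg M c < e * c.
  by rewrite -ltr_pdivrMr //; apply: le_lt_trans hcl; exact: ler_norm.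
have t0 : 0 <= 2^-1 :> R by lra.
have t1 : 2^-1 <= 1 :> R by lra.
have := orlicz_scale hM t0 t1 (ltW u0).
rewrite mulrC => hs.
have M_le : M u <= derive_nneg M c * u by lra.
apply: le_trans M_le _; rewrite expr2 mulrA ler_wpM2r ?(ltW u0) //.
by apply: ltW; apply: lt_trans dc _; rewrite ltr_pM2l.
Qed.

(** The function M - m u^2 / 2 is convex and nondecreasing on [x, y] as soon as
    m is below the minimum of M'' on [x, y] and below M'(x) / x; the gain
    m d^2 is what the quadratic term contributes. *)
Lemma orlicz_midpoint_curved : midpoint_curved M.
Proof.
move=> x y x0 xy.
have cM2 : {within `[x, y], continuous (derive_nneg (derive_nneg M))}.
  apply: continuous_subspaceW hM2c => z /=; rewrite !in_itv /= andbT.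
  by move=> /andP[xz _]; lra.
(* m is taken below the minimum of M'' on [x, y], so that dH increases, and
   below M'(x) / x, so that dH is nonnegative at x, hence on [x, y]. *)
have [c cxy hc] := EVT_min (ltW xy) cM2.
have c0 : 0 < c by move: cxy; rewrite in_itv /= => /andP[]; lra.
have M2c0 := hM2p c0.
have M1x : 0 < derive_nneg M x.
  have x4 : 0 < x / 4 by lra.
  have x42 : x / 4 < x / 2 by lra.
  have [t] := MVT_pos x4 x42 is_derive_nneg.
  rewrite in_itv /= => /andP[t1 t2] ht.
  have tx : t < x by lra.
  have t0 : 0 < t by lra.
  have Mt : 0 <= derive_nneg M t.
    have : M (x / 4) <= M (x / 2) by apply: (orlicz_le hM); lra.
    by rewrite -subr_ge0 ht pmulr_lge0 //; lra.
  have [z] := MVT_pos t0 tx is_derive2_nneg.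
  rewrite in_itv /= => /andP[z1 z2] hz.
  have : 0 < derive_nneg (derive_nneg M) z by apply: hM2p; lra.
  nra.
pose m := Num.min (derive_nneg (derive_nneg M) c) (derive_nneg M x / x).
have m0 : 0 < m by rewrite lt_min M2c0 divr_gt0.
have mx : m * x <= derive_nneg M x.
  by rewrite -ler_pdivlMr // ge_min lexx orbT.
have mM2 (u : R) : u \in `[x, y] -> m <= derive_nneg (derive_nneg M) u.
  by move=> /hc h; rewrite ge_min h.
pose H u := M u - m / 2 * u ^+ 2.
pose dH u := derive_nneg M u - m * u.
have HdH (u : R) : 0 < u -> is_derive u 1 H (dH u).
  move=> u0; have ? := is_derive_nneg u0.
  rewrite /H /dH; apply: is_derive_eq.
  by rewrite /GRing.scale /=; field.
have dH2 (u : R) : 0 < u -> is_derive u 1 dH (derive_nneg (derive_nneg M) u - m).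
  move=> u0; have ? := is_derive2_nneg u0.
  rewrite /dH; apply: is_derive_eq.
  by rewrite /GRing.scale /= mulr1.
have dH_homo (u v : R) : x <= u -> u < v -> v <= y -> dH u <= dH v.
  move=> xu uv vy; have u0 : 0 < u by lra.
  have [z] := MVT_pos u0 uv dH2.
  rewrite in_itv /= => /andP[z1 z2] hz.
  rewrite -subr_ge0 hz mulr_ge0 ?subr_ge0 ?mM2 //; [|lra].
  by rewrite in_itv /=; apply/andP; split; lra.
have dH_ge0 (u : R) : x < u -> u <= y -> 0 <= dH u.
  by move=> xu uy; apply: le_trans (dH_homo x u _ _ _) => //; rewrite subr_ge0.
have H_homo (u v : R) : x <= u -> u <= v -> v <= y -> H u <= H v.
  move=> xu; rewrite le_eqVlt => /orP[/eqP -> //|uv] vy.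
  have u0 : 0 < u by lra.
  have [z] := MVT_pos u0 uv HdH.
  rewrite in_itv /= => /andP[z1 z2] hz.
  rewrite -subr_ge0 hz mulr_ge0 ?dH_ge0 //; lra.
have H_mid (p q : R) : x <= p -> p <= q -> q <= y -> 2 * H ((p + q) / 2) <= H p + H q.
  move=> xp; rewrite le_eqVlt => /orP[/eqP -> _|pq qy].
    have -> : (q + q) / 2 = q by lra.
    by lra.
  have p0 : 0 < p by lra.
  have ps : p < (p + q) / 2 by lra.
  have s0 : 0 < (p + q) / 2 by lra.
  have sq : (p + q) / 2 < q by lra.
  have [z1] := MVT_pos p0 ps HdH.
  have [z2] := MVT_pos s0 sq HdH.
  rewrite !in_itv /= => /andP[? ?] h2 /andP[? ?] h1.
  have /= h := dH_homo z1 z2.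
  have : dH z1 <= dH z2 by apply: h; lra.
  nra.
exists m => // p q a d.
wlog pq : p q / p <= q.
  move=> h; have [pq|/ltW qp] := leP p q; first exact: h.
  by move=> pI qI aI; rewrite [p + q]addrC [p ^+ 2 + _]addrC [M p + _]addrC; exact: h.
rewrite !in_itv /= => /andP[xp py] /andP[xq qy] /andP[xa ay] apq hd.
have h1 := H_mid _ _ xp pq qy.
have h2 : H a <= H ((p + q) / 2) by apply: H_homo => //; lra.
rewrite /H in h1 h2.
nra.
Qed.
End SecondDerivative.

(** * Real and complex scalars *)

Lemma modulus_complex (R : realType) (z : R[i]%C) :
  @modulus R ComplexScalars z =
  Num.sqrt (complex.Re z ^+ 2 + complex.Im z ^+ 2).
Proof. by rewrite /modulus normc_def. Qed.

Section Scalars.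
Context {R : realType} {k : scalar_kind}.
Local Notation K := (scalar_field R k).
Implicit Types (z w : K) (A D : set R) (f g : R -> K).

Lemma modulus_ge0 z : 0 <= modulus z.
Proof.
by case: k z => z; [exact: normr_ge0|rewrite modulus_complex sqrtr_ge0].
Qed.

Lemma modulus_eq0 z : (modulus z == 0) = (z == 0).
Proof.
case: k z => z; first exact: normr_eq0.
rewrite -[RHS]normr_eq0 normc_def modulus_complex.
by rewrite eq_complex /= eqxx andbT.
Qed.

Lemma modulus0 : modulus (0 : K) = 0.
Proof. by apply/eqP; rewrite modulus_eq0. Qed.

Lemma modulusN z : modulus (- z) = modulus z.
Proof. by case: k z => z; rewrite /modulus normrN. Qed.

Lemma modulusM z w : modulus (z * w) = modulus z * modulus w.
Proof.
case: k z w => z w; rewrite /modulus normrM //.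
by rewrite !normc_def /= mulr0 subr0.
Qed.

Lemma modulusD_le z w : modulus (z + w) <= modulus z + modulus w.
Proof.
case: k z w => z w; first exact: ler_normD.
have := ler_normD z w; rewrite /modulus !normc_def lecE /= => /andP[_].
exact.
Qed.

Lemma modulus_parallelogram z w : modulus (z + w) ^+ 2 + modulus (z - w) ^+ 2 =
  2 * modulus z ^+ 2 + 2 * modulus w ^+ 2.
Proof.
case: k z w => z w; first by rewrite /modulus !real_normK ?num_real //; ring.
rewrite !modulus_complex !sqr_sqrtr ?addr_ge0 ?sqr_ge0 //.
by case: z w => [a b] [c d] /=; ring.
Qed.

Lemma modulus_double z : modulus (z + z) = 2 * modulus z.
Proof.
case: k z => z; rewrite /modulus -mulr2n normrMn mulr_natl //.
Qed.

Lemma modulus_onto (t : R) : 0 <= t -> exists z, modulus z = t.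
Proof.
move=> t0; case: k; first by exists t; exact: ger0_norm.
by exists (t%:C)%C; rewrite modulus_complex /= expr0n addr0 sqrtr_sqr ger0_norm.
Qed.

Lemma scalar_measurableD D f g : measurable D ->
  scalar_measurable D f -> scalar_measurable D g ->
  scalar_measurable D (fun x => f x + g x).
Proof.
case: k f g => f g mD /=; first exact: measurable_funD.
move=> [mf1 mf2] [mg1 mg2]; split.
- under eq_fun do rewrite raddfD /=; exact: measurable_funD.
- under eq_fun do rewrite raddfD /=; exact: measurable_funD.
Qed.

Lemma scalar_measurableZ D (z : K) f : measurable D ->
  scalar_measurable D f -> scalar_measurable D (fun x => z * f x).
Proof.
case: k z f => z f mD /=; first by move=> mf; exact: measurable_funM.
move=> [mf1 mf2]; case: z => a b; split.
- rewrite (_ : (fun _ => _) = (fun x => a * complex.Re (f x) - b * complex.Im (f x))).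
    by apply: measurable_funB; exact: measurable_funM.
  by apply/funext => x; case: (f x).
- rewrite (_ : (fun _ => _) = (fun x => a * complex.Im (f x) + b * complex.Re (f x))).
    by apply: measurable_funD; exact: measurable_funM.
  by apply/funext => x; case: (f x).
Qed.

Lemma scalar_measurable_if D (p : R -> bool) f : measurable D ->
  measurable_fun D p -> scalar_measurable D f ->
  scalar_measurable D (fun x => if p x then f x else 0).
Proof.
move=> mD mp; have mif (h : R -> R) : measurable_fun D h ->
    measurable_fun D (fun x => if p x then h x else 0).
  move=> mh; apply: measurable_fun_if => //.
  by apply: measurable_funS mh => //; exact: subIsetl.
case: k f => f /=; first exact: mif.
move=> [mf1 mf2]; split.
- under eq_fun do rewrite (fun_if (@complex.Re _)) /=.
  exact: mif.
- under eq_fun do rewrite (fun_if (@complex.Im _)) /=.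
  exact: mif.
Qed.

Lemma measurable_modulus D f : measurable D ->
  scalar_measurable D f -> measurable_fun D (fun x => modulus (f x)).
Proof.
case: k f => f mD /=; first by move=> mf; exact: measurableT_comp.
move=> [mf1 mf2].
rewrite (_ : (fun _ => _) =
    (fun x => Num.sqrt (complex.Re (f x) ^+ 2 + complex.Im (f x) ^+ 2))).
  apply: (@measurableT_comp _ _ _ _ _ _ (@Num.sqrt R) _
    (fun x => complex.Re (f x) ^+ 2 + complex.Im (f x) ^+ 2)).
    by apply: continuous_measurable_fun; exact: sqrt_continuous.
  by apply: measurable_funD; exact: measurable_funX.
by apply/funext => x; exact: modulus_complex.
Qed.

End Scalars.

(** * Integrals of nonnegative functions *)

Section NonnegIntegral.
Local Open Scope ereal_scope.
Context {R : realType}.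
Local Notation mu := (@lebesgue_measure R).
Implicit Types (D E : set R) (h : R -> R).

Lemma integral_linear2 D h1 h2 (a b : R) : measurable D ->
  measurable_fun D h1 -> measurable_fun D h2 ->
  (forall x, D x -> (0 <= h1 x)%R) -> (forall x, D x -> (0 <= h2 x)%R) ->
  (0 <= a)%R -> (0 <= b)%R ->
  \int[mu]_(x in D) (a * h1 x + b * h2 x)%R%:E =
  a%:E * \int[mu]_(x in D) (h1 x)%:E + b%:E * \int[mu]_(x in D) (h2 x)%:E.
Proof.
move=> mD mh1 mh2 h10 h20 a0 b0.
under eq_integral do rewrite EFinD !EFinM.
rewrite ge0_integralD //.
- by rewrite !ge0_integralZl_EFin //; exact/measurable_EFinP.
- by move=> x Dx; rewrite mule_ge0 ?lee_fin ?h10.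
- by apply: measurable_funeM; exact/measurable_EFinP.
- by move=> x Dx; rewrite mule_ge0 ?lee_fin ?h20.
- by apply: measurable_funeM; exact/measurable_EFinP.
Qed.

Lemma le_integral_EFin D h1 h2 : measurable D ->
  measurable_fun D h1 -> measurable_fun D h2 ->
  (forall x, D x -> (0 <= h1 x)%R) ->
  (forall x, D x -> (h1 x <= h2 x)%R) ->
  \int[mu]_(x in D) (h1 x)%:E <= \int[mu]_(x in D) (h2 x)%:E.
Proof.
move=> mD mh1 mh2 h10 h12; apply: ge0_le_integral => //.
- exact/measurable_EFinP.
- exact/measurable_EFinP.
Qed.

Lemma integral_ge_cst D E h (c : R) : measurable D -> measurable E -> E `<=` D ->
  measurable_fun D h -> (0 <= c)%R -> (forall x, D x -> (0 <= h x)%R) ->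
  (forall x, E x -> (c <= h x)%R) ->
  c%:E * mu E <= \int[mu]_(x in D) (h x)%:E.
Proof.
move=> mD mE ED mh c0 h0 ch.
apply: (@le_trans _ _ (\int[mu]_(x in E) (h x)%:E)); last first.
  by apply: ge0_subset_integral => //; exact/measurable_EFinP.
rewrite -(integral_cst mu mE c%:E).
by apply: le_integral_EFin => //; exact: measurable_funS mh.
Qed.

Lemma null_of_level_sets D h : measurable D -> measurable_fun D h ->
  (forall d : R, (0 < d)%R -> mu (D `&` [set x | (d <= h x)%R]) = 0) ->
  mu (D `&` [set x | (0 < h x)%R]) = 0.
Proof.
move=> mD mh h0.
have ml (d : R) : measurable (D `&` [set x | (d <= h x)%R]).
  have := mh mD `[d, +oo[%classic (measurable_itv _).
  by congr measurable; apply/seteqP; split => x /=; rewrite in_itv /= andbT.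
have m0 : measurable (D `&` [set x | (0 < h x)%R]).
  have := mh mD `]0%R, +oo[%classic (measurable_itv _).
  by congr measurable; apply/seteqP; split => x /=; rewrite in_itv /= andbT.
have hU : mu.-negligible (\bigcup_n (D `&` [set x | (n.+1%:R^-1 <= h x)%R])).
  apply: negligible_bigcup => n; apply/negligibleP; first exact: ml.
  by apply: h0; rewrite invr_gt0.
apply: measure_negligible; first exact: m0.
apply: negligibleS hU => x [Dx /= hx].
have [n _ hn] := near_infty_natSinv_lt (PosNum hx).
by exists n => //; split => //=; apply/ltW/hn => /=.
Qed.

End NonnegIntegral.

(** * The modular and the Luxemburg norm *)

Section Modular.
Context {R : realType} {k : scalar_kind} {M : R -> R}.
Local Notation K := (scalar_field R k).
Local Notation mu := (@lebesgue_measure R).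
Local Notation I01 := (`[0, 1]%classic : set R).
Implicit Types (f g : R -> K) (l : R).
Hypothesis hM : orlicz_function M.
Hypothesis hD : Delta2 M.

(** The modular of f at scale l, whose sublevel at 1 defines the Luxemburg
    norm. *)
Definition orlicz_modular f l : \bar R :=
  (\int[mu]_(x in I01) (M (modulus (f x) / l))%:E)%E.

Lemma measurable_I01 : measurable I01. Proof. exact: measurable_itv. Qed.

Lemma mu_I01 : mu I01 = 1%E.
Proof. by rewrite lebesgue_measure_itv /= lte_fin ltr01 sube0. Qed.

Lemma measurable_orlicz_modulus f l : 0 <= l -> scalar_measurable I01 f ->
  measurable_fun I01 (fun x => M (modulus (f x) / l)).
Proof.
move=> l0 mf; apply: (orlicz_measurable hM) => //.
- by apply: measurable_funM => //; exact: measurable_modulus.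
- by move=> x _; rewrite divr_ge0 // modulus_ge0.
Qed.

Lemma orlicz_modulus_ge0 f l x : 0 <= l -> 0 <= M (modulus (f x) / l).
Proof. by move=> l0; rewrite (orlicz_ge0 hM) // divr_ge0 // modulus_ge0. Qed.

Lemma modular_ge0 f l : 0 <= l -> (0 <= orlicz_modular f l)%E.
Proof.
by move=> l0; apply: integral_ge0 => x _; rewrite lee_fin orlicz_modulus_ge0.
Qed.

Lemma modular_anti f l l' : scalar_measurable I01 f -> 0 < l -> l <= l' ->
  (orlicz_modular f l' <= orlicz_modular f l)%E.
Proof.
move=> mf l0 ll'; have l'0 : 0 < l' by exact: lt_le_trans ll'.
apply: le_integral_EFin => //.
- by apply: measurable_orlicz_modulus => //; exact: ltW.
- by apply: measurable_orlicz_modulus => //; exact: ltW.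
- by move=> x _; apply: orlicz_modulus_ge0; exact: ltW.
- move=> x _; apply: (orlicz_le hM).
    by rewrite divr_ge0 ?modulus_ge0 // ltW.
  by rewrite ler_wpM2l ?modulus_ge0 // lef_pV2.
Qed.

Lemma luxemburg_norm_ge0 f : (0 <= luxemburg_norm M f)%E.
Proof. by apply: le_ereal_inf_tmp => _ [l [l0 _] <-]; rewrite lee_fin ltW. Qed.

Lemma luxemburg_norm_le f l : 0 < l -> (orlicz_modular f l <= 1)%E ->
  (luxemburg_norm M f <= l%:E)%E.
Proof. by move=> l0 h; apply: ereal_inf_lbound; exists l. Qed.

Lemma modular_le1 f l : scalar_measurable I01 f ->
  (luxemburg_norm M f < l%:E)%E -> (orlicz_modular f l <= 1)%E.
Proof.
move=> mf /ereal_inf_lt[_ [l' [l'0 h] <-]]; rewrite lte_fin => l'l.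
by apply: le_trans h; apply: modular_anti => //; exact: ltW.
Qed.

Lemma modular_fin f l : orlicz_space M f -> 0 < l -> (orlicz_modular f l < +oo)%E.
Proof.
move=> [mf /ereal_inf_lt[_ [l' [l'0 h] <-]] _] l0.
have s0 : 0 <= l' / l by rewrite divr_ge0 // ltW.
have [c [e [c0 e0 hce]]] := Delta2_affine hM hD s0.
have ml' : measurable_fun I01 (fun x => M (modulus (f x) / l')).
  by apply: measurable_orlicz_modulus => //; exact: ltW.
apply: (@le_lt_trans _ _ (\int[mu]_(x in I01) (c * M (modulus (f x) / l') + e * 1)%:E)%E).
  apply: le_integral_EFin => //.
  - by apply: measurable_orlicz_modulus => //; exact: ltW.
  - by apply: measurable_funD => //; apply: measurable_funM.
  - by move=> x _; apply: orlicz_modulus_ge0; exact: ltW.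
  - move=> x _; have : 0 <= modulus (f x) / l' by rewrite divr_ge0 ?modulus_ge0 // ltW.
    move=> /hce; rewrite mulr1; congr (M _ <= _).
    by field; rewrite !gt_eqF.
rewrite integral_linear2 //; last by move=> x _; apply: orlicz_modulus_ge0; exact: ltW.
have -> : (\int[mu]_(x in I01) 1%:E = 1)%E.
  by rewrite (integral_cst mu measurable_I01 1%E) mul1e; exact: mu_I01.
rewrite mule1.
rewrite lte_add_pinfty ?ltry //.
apply: (@le_lt_trans _ _ (c%:E * 1)%E); last by rewrite mule1 ltry.
by rewrite lee_wpmul2l ?lee_fin.
Qed.

Lemma modular_dilation f l (t : R) : orlicz_space M f -> 0 < l -> 1 <= t ->
  (orlicz_modular f l <=
   orlicz_modular f (l * t) + (t - 1)%:E * orlicz_modular f (l / 2))%E.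
Proof.
move=> [mf _] l0 t1; have t0 : 0 < t by lra.
have lt0 : 0 <= l * t by rewrite mulr_ge0 // ltW.
have l20 : 0 <= l / 2 by rewrite divr_ge0 // ltW.
rewrite -[X in (X + _)%E]mul1e /orlicz_modular -integral_linear2 //; last 5 first.
- exact: measurable_orlicz_modulus.
- exact: measurable_orlicz_modulus.
- by move=> x _; apply: orlicz_modulus_ge0.
- by move=> x _; apply: orlicz_modulus_ge0.
- by rewrite subr_ge0.
apply: le_integral_EFin => //.
- by apply: measurable_orlicz_modulus => //; exact: ltW.
- by apply: measurable_funD; apply: measurable_funM => //;
    exact: measurable_orlicz_modulus.
- by move=> x _; apply: orlicz_modulus_ge0; exact: ltW.
- move=> x _; have ml0 : 0 <= modulus (f x) / l.
    by rewrite divr_ge0 ?modulus_ge0 // ltW.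
  have := orlicz_dilation hM t1 ml0; rewrite mul1r.
  have -> : modulus (f x) / l / t = modulus (f x) / (l * t).
    by field; rewrite !gt_eqF.
  have -> // : 2 * (modulus (f x) / l) = modulus (f x) / (l / 2).
  by field; rewrite !gt_eqF.
Qed.

(** Delta_2 makes the modular continuous in the scale, so that the value 1 is
    attained at the norm. *)
Lemma modular_luxemburg_norm f (rho : R) : orlicz_space M f -> 0 < rho ->
  luxemburg_norm M f = rho%:E -> orlicz_modular f rho = 1%E.
Proof.
move=> Mf rho0 nf; have [mf _] := Mf.
have fin l : 0 < l -> orlicz_modular f l \is a fin_num.
  by move=> l0; rewrite ge0_fin_numE ?modular_fin // modular_ge0 // ltW.
have fineE l : 0 < l -> orlicz_modular f l = (fine (orlicz_modular f l))%:E.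
  by move=> l0; rewrite fineK // fin.
have C0 l : 0 < l -> 0 <= fine (orlicz_modular f l).
  by move=> l0; rewrite fine_ge0 // modular_ge0 // ltW.
apply/le_anti/andP; split.
- pose C := fine (orlicz_modular f (rho / 2)).
  have le t : 1 < t -> fine (orlicz_modular f rho) <= 1 + (t - 1) * C.
    move=> t1; have := modular_dilation Mf rho0 (ltW t1).
    have rt0 : 0 < rho * t by rewrite mulr_gt0 //; lra.
    have : (orlicz_modular f (rho * t) <= 1)%E.
      by apply: modular_le1 => //; rewrite nf lte_fin ltr_pMr.
    rewrite (fineE _ rt0) (fineE _ rho0) (fineE (rho / 2)) ?divr_gt0 //.
    rewrite -EFinM -EFinD !lee_fin -/C; lra.
  rewrite (fineE _ rho0) lee_fin.
  apply/ler_addgt0Pr => e e0.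
  have C1 : 0 < C + 1 by have := C0 (rho / 2); rewrite divr_gt0 // -/C => /(_ isT); lra.
  have t1 : 1 < 1 + e / (C + 1) by rewrite ltrDl divr_gt0.
  apply: le_trans (le _ t1) _; rewrite addrAC subrr add0r lerD2l.
  by rewrite mulrAC ler_pdivrMr // ler_wpM2l ?(ltW e0) // lerDl.
- pose C := fine (orlicz_modular f (rho / 4)).
  have le t : 1 < t -> t <= 2 -> 1 <= fine (orlicz_modular f rho) + (t - 1) * C.
    move=> t1 t2; have t0 : 0 < t by lra.
    have rt0 : 0 < rho / t by rewrite divr_gt0.
    have rt20 : 0 < rho / t / 2 by rewrite divr_gt0.
    have := modular_dilation Mf rt0 (ltW t1).
    have h1 : (1 < orlicz_modular f (rho / t))%E.
      rewrite ltNge; apply/negP => /(luxemburg_norm_le rt0); rewrite nf lee_fin.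
      by rewrite ler_pdivlMr // leNgt ltr_pMr // t1.
    have h2 : (orlicz_modular f (rho / t / 2) <= orlicz_modular f (rho / 4))%E.
      apply: modular_anti => //; first by rewrite divr_gt0.
      by rewrite -mulrA -invfM ler_wpM2l ?(ltW rho0) // lef_pV2 ?posrE; lra.
    move: h1 h2; rewrite (fineE _ rt0) (fineE _ rt20) divfK ?gt_eqF //.
    rewrite (fineE _ rho0) (fineE (rho / 4)) ?divr_gt0 //.
    rewrite -EFinM -EFinD !lee_fin lte_fin -/C => h1 h2 h3.
    nra.
  rewrite (fineE _ rho0) lee_fin.
  apply/ler_addgt0Pr => e e0.
  have C1 : 0 < C + 1 by have := C0 (rho / 4); rewrite divr_gt0 // -/C => /(_ isT); lra.
  (* The bound 1 keeps the scale rho / t / 2 above rho / 4. *)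
  pose d := Num.min (e / (C + 1)) 1.
  have d0 : 0 < d by rewrite lt_min divr_gt0 //= ltr01.
  have d1 : d <= 1 by rewrite ge_min lexx orbT.
  have de : d * (C + 1) <= e by rewrite -ler_pdivlMr // ge_min lexx.
  have := le (1 + d); nra.
Qed.


Lemma modular_ae_eq f g l : 0 <= l ->
  scalar_measurable I01 f -> scalar_measurable I01 g ->
  ae_eq mu I01 f g -> orlicz_modular f l = orlicz_modular g l.
Proof.
move=> l0 mf mg fg; apply: ge0_ae_eq_integral => //.
- by apply/measurable_EFinP; exact: measurable_orlicz_modulus.
- by apply/measurable_EFinP; exact: measurable_orlicz_modulus.
- by move=> x _; rewrite lee_fin orlicz_modulus_ge0.
- by move=> x _; rewrite lee_fin orlicz_modulus_ge0.
- by apply: filterS fg => x /[apply] ->.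
Qed.

(** Modulars at most 1 at every scale force a function to vanish.  The integral
    runs over a subset A because two functions are to be compared on the support
    of a third one. *)
Lemma null_of_modular f A : measurable A -> A `<=` I01 -> scalar_measurable I01 f ->
  (forall l, 0 < l -> (\int[mu]_(x in A) (M (modulus (f x) / l))%:E <= 1)%E) ->
  mu (A `&` supp f) = 0%E.
Proof.
move=> mA AI mf h.
have mmf : measurable_fun A (fun x => modulus (f x)).
  by apply: (@measurable_funS _ _ _ _ I01) => //; exact: measurable_modulus.
have -> : A `&` supp f = A `&` [set x | 0 < modulus (f x)].
  apply/seteqP; split => x [Ax /=].
    by move=> [_ fx0]; split => //=; rewrite lt_def modulus_ge0 modulus_eq0 fx0.
  by move=> fx0; split => //; split; [exact: AI|rewrite -modulus_eq0 gt_eqF].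
apply: null_of_level_sets => // d d0.
set E := A `&` _.
have mE : measurable E.
  have := mmf mA `[d, +oo[%classic (measurable_itv _).
  by congr measurable; apply/seteqP; split => x /=; rewrite in_itv /= andbT.
(* Scale d / t: on E the argument of M is at least t, and M t >= t. *)
have bound t : 1 <= t -> (t%:E * mu E <= 1)%E.
  move=> t1; have t0 : 0 < t by lra.
  have l0 : 0 < d / t by rewrite divr_gt0.
  apply: le_trans (h _ l0); apply: integral_ge_cst => //.
  - exact: subIsetl.
  - apply: (@measurable_funS _ _ _ _ I01) => //.
    by apply: measurable_orlicz_modulus => //; exact: ltW.
  - exact: ltW.
  - by move=> x _; apply: orlicz_modulus_ge0; exact: ltW.
  - move=> x [Ax /= dx].
    have tm : t <= modulus (f x) / (d / t).
      by rewrite invf_div mulrCA ler_peMr ?(ltW t0) // ler_pdivlMr // mul1r.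
    apply: (le_trans tm); apply: (orlicz_ge_id hM).
    exact: le_trans tm.
have e1 : (mu E <= 1)%E by have := bound 1 (lexx _); rewrite mul1e.
have e0 : (0 <= mu E)%E by exact: measure_ge0.
have efin : mu E = (fine (mu E))%:E.
  by rewrite fineK // ge0_fin_numE // (le_lt_trans e1) // ltry.
have ee0 : 0 <= fine (mu E) by rewrite fine_ge0.
move: bound; rewrite efin; move: (fine _) ee0 => e ee bound.
apply/eqP; rewrite eqe; apply/contraT => en0.
have e_gt0 : 0 < e by rewrite lt_def en0.
have t1 : 1 <= 2 / e + 1 by rewrite lerDr divr_ge0.
have := bound _ t1; rewrite -EFinM lee_fin.
have -> : (2 / e + 1) * e = 2 + e by field; rewrite gt_eqF.
lra.
Qed.

End Modular.
Arguments orlicz_modular {R k} M f l.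

(** * The norm of f + c g from above and from below *)

Section NormEstimates.
Context {R : realType} {k : scalar_kind} {M : R -> R}.
Local Notation K := (scalar_field R k).
Local Notation mu := (@lebesgue_measure R).
Local Notation I01 := (`[0, 1]%classic : set R).
Implicit Types (f g F G : R -> K) (l : R).
Hypothesis hM : orlicz_function M.
Hypothesis hD : Delta2 M.

Lemma modular_le_modulus f g l : scalar_measurable I01 f ->
  scalar_measurable I01 g -> 0 <= l ->
  (forall x, I01 x -> modulus (g x) <= modulus (f x)) ->
  (orlicz_modular M g l <= orlicz_modular M f l)%E.
Proof.
move=> mf mg l0 gf; apply: le_integral_EFin => //.
- exact: measurable_orlicz_modulus.
- exact: measurable_orlicz_modulus.
- by move=> x _; apply: (orlicz_modulus_ge0 hM).
- move=> x Ix; apply: (orlicz_le hM).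
    by rewrite divr_ge0 ?modulus_ge0.
  by rewrite ler_wpM2r ?invr_ge0 ?gf.
Qed.

Lemma orlicz_space_le_modulus f g : orlicz_space M f ->
  scalar_measurable I01 g ->
  (forall x, I01 x -> modulus (g x) <= modulus (f x)) -> orlicz_space M g.
Proof.
move=> [mf /ereal_inf_lt[_ [l [l0 h] <-]] _] mg gf; split => //.
apply: (@le_lt_trans _ _ l%:E); last exact: ltry.
apply: luxemburg_norm_le => //; apply: le_trans h.
exact: modular_le_modulus mf mg (ltW l0) gf.
Qed.

(** For disjoint f and g the two integrals decouple, whence an upper bound of
    the norm that is o(|c|^2) away from the norm of f. *)
Lemma norm_disjoint_perturbation f g (c : K) (B rho : R) :
  orlicz_space M f -> scalar_measurable I01 g -> 0 < rho ->
  luxemburg_norm M f = rho%:E ->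
  (forall x, I01 x -> f x = 0 \/ g x = 0) ->
  (forall x, I01 x -> modulus (g x) <= B) ->
  (luxemburg_norm M (fun x => (f x + c * g x)%R) <=
    (rho * (1 + M (modulus c * B / rho)))%:E)%E.
Proof.
move=> Mf mg rho0 nf fg gB; have [mf _] := Mf.
have B0 : 0 <= B.
  by apply: le_trans (gB 0 _); rewrite ?modulus_ge0 //= in_itv /= lexx ler01.
set th := M _.
have arg0 : 0 <= modulus c * B / rho.
  by rewrite divr_ge0 ?mulr_ge0 ?modulus_ge0 ?(ltW rho0).
have th0 : 0 <= th by apply: (orlicz_ge0 hM).
have s0 : 0 < 1 + th by lra.
have l0 : 0 < rho * (1 + th) by rewrite mulr_gt0.
have i0 : 0 <= (1 + th)^-1 by rewrite invr_ge0 ltW.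
have i1 : (1 + th)^-1 <= 1 by rewrite invf_le1 // lerDl.
apply: luxemburg_norm_le => //.
have mm : measurable_fun I01 (fun x => M (modulus (f x) / rho)).
  by apply: measurable_orlicz_modulus => //; exact: ltW.
apply: (@le_trans _ _ (\int[mu]_(x in I01)
    ((1 + th)^-1 * M (modulus (f x) / rho) + (1 + th)^-1 * th * 1)%:E)%E).
  apply: le_integral_EFin => //.
  - apply: measurable_orlicz_modulus => //; first exact: ltW.
    by apply: scalar_measurableD => //; exact: scalar_measurableZ.
  - by apply: measurable_funD => //; apply: measurable_funM.
  - move=> x _.
    by apply: (@orlicz_modulus_ge0 _ _ _ hM (fun x => f x + c * g x)); exact: ltW.
  - move=> x Ix.
    have shrink z : 0 <= z -> M (z / (rho * (1 + th))) <= (1 + th)^-1 * M (z / rho).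
      move=> z0; rewrite (_ : z / _ = (1 + th)^-1 * (z / rho)); last first.
        by field; rewrite !gt_eqF.
      by apply: (orlicz_scale hM) => //; rewrite divr_ge0 // ltW.
    have fm0 : 0 <= M (modulus (f x) / rho).
      by apply: (orlicz_modulus_ge0 hM); exact: ltW.
    have [fx|gx] := fg x Ix.
      rewrite fx add0r modulusM mulr1.
      apply: (@le_trans _ _ ((1 + th)^-1 * th)); last by rewrite lerDr mulr_ge0 // -fx.
      apply: le_trans (shrink _ _) _; first by rewrite mulr_ge0 ?modulus_ge0.
      rewrite ler_wpM2l //; apply: (orlicz_le hM).
        by rewrite divr_ge0 ?mulr_ge0 ?modulus_ge0 ?ltW.
      rewrite ler_wpM2r ?invr_ge0 ?(ltW rho0) //.
      by rewrite ler_wpM2l ?modulus_ge0 ?gB.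
    rewrite gx mulr0 addr0 mulr1.
    by apply: le_trans (shrink _ (modulus_ge0 _)) _; rewrite lerDl mulr_ge0.
rewrite integral_linear2 //; last 2 first.
- by move=> x _; apply: (orlicz_modulus_ge0 hM); exact: ltW.
- by rewrite mulr_ge0.
have -> : (\int[mu]_(x in I01) 1%:E = 1)%E.
  by rewrite (integral_cst mu (@measurable_I01 R) 1%E) mul1e; exact: mu_I01.
have fnorm := modular_luxemburg_norm hM hD Mf rho0 nf.
rewrite /orlicz_modular in fnorm; rewrite fnorm.
rewrite !mule1 -EFinD lee_fin.
have -> : (1 + th)^-1 + (1 + th)^-1 * th = 1 by field; rewrite gt_eqF.
exact: lexx.
Qed.

(** If |F| and |G| lie between d and B on E, the norms of F + c G and F - c G
    cannot both be within a relative error tau of the norm of F, for small c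
    and tau <= 1, unless tau is at least a multiple of |c|^2 mu(E). *)
Lemma curvature_estimate F G (E : set R) (d B rho : R) : midpoint_curved M ->
  orlicz_space M F -> scalar_measurable I01 G -> 0 < rho ->
  luxemburg_norm M F = rho%:E -> measurable E -> E `<=` I01 ->
  0 < d -> d <= B ->
  (forall x, E x -> d <= modulus (F x) /\ modulus (F x) <= B) ->
  (forall x, E x -> d <= modulus (G x) /\ modulus (G x) <= B) ->
  exists a0 kap C : R, [/\ 0 < a0, 0 < kap, 0 <= C &
    forall (c : K) (tau : R), modulus c <= a0 -> 0 <= tau -> tau <= 1 ->
      (orlicz_modular M (fun x => (F x + c * G x)%R) (rho * (1 + tau)) <= 1)%E ->
      (orlicz_modular M (fun x => (F x + - c * G x)%R) (rho * (1 + tau)) <= 1)%E ->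
      kap * modulus c ^+ 2 * fine (mu E) <= tau * C].
Proof.
move=> curved MF mG rho0 nF mE EI d0 dB hF hG; have [mF _] := MF.
have B0 : 0 < B by lra.
have x0 : 0 < d / (4 * rho) by rewrite divr_gt0 // mulr_gt0.
have xy : d / (4 * rho) < 2 * B / rho.
  by rewrite invfM mulrA ltr_pM2r ?invr_gt0 //; lra.
have [m m0 hm] := curved _ _ x0 xy.
(* For |c| <= d / (2 B) the moduli of F + c G and F - c G lie between d / 2 and
   2 B on E, and dividing by l in [rho, 2 rho] lands in the interval above. *)
exists (d / (2 * B)), (m * d ^+ 2 / (4 * rho ^+ 2)),
  (2 * fine (orlicz_modular M F (rho / 2))).
have r20 : 0 < rho / 2 by rewrite divr_gt0.
split.
- by rewrite divr_gt0 // mulr_gt0.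
- by rewrite divr_gt0 ?mulr_gt0 ?exprn_gt0.
- by rewrite mulr_ge0 // fine_ge0 // modular_ge0 // ltW.
move=> c tau ca tau0 tau1; set l := rho * (1 + tau).
have l0 : 0 < l by rewrite mulr_gt0 //; lra.
have lrho : rho <= l by rewrite ler_peMr ?(ltW rho0) //; lra.
have l2rho : l <= 2 * rho by rewrite /l; nra.
set P := fun x => F x + c * G x; set Q := fun x => F x + - c * G x.
set kap := m * _ / _.
have kap0 : 0 <= kap.
  by rewrite divr_ge0 ?mulr_ge0 ?exprn_ge0 ?(ltW rho0) ?(ltW m0) ?(ltW d0).
move=> hP hQ.
have mP : scalar_measurable I01 P.
  by apply: scalar_measurableD => //; exact: scalar_measurableZ.
have mQ : scalar_measurable I01 Q.
  by apply: scalar_measurableD => //; exact: scalar_measurableZ.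
have QE x : Q x = F x - c * G x by rewrite /Q mulNr.
pose p x := modulus (P x) / l; pose q x := modulus (Q x) / l.
pose a x := modulus (F x) / l.
have a0 x : 0 <= a x by rewrite divr_ge0 ?modulus_ge0 // ltW.
have p0 x : 0 <= p x by rewrite divr_ge0 ?modulus_ge0 // ltW.
have q0 x : 0 <= q x by rewrite divr_ge0 ?modulus_ge0 // ltW.
have apq x : 2 * a x <= p x + q x.
  rewrite /a /p /q mulrA -mulrDl ler_wpM2r ?invr_ge0 ?(ltW l0) //.
  have := modulusD_le (P x) (Q x).
  have -> : P x + Q x = F x + F x by rewrite QE /P addrACA subrr addr0.
  by rewrite modulus_double.
have sq x : p x ^+ 2 + q x ^+ 2 =
    2 * a x ^+ 2 + 2 * (modulus c * modulus (G x) / l) ^+ 2.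
  have := modulus_parallelogram (F x) (c * G x).
  rewrite -QE -/(P x) modulusM /p /q /a !expr_div_n => h.
  by rewrite -mulrDl h; ring.
have aM x : M (modulus (F x) / rho) <= M (a x) + tau * M (modulus (F x) / (rho / 2)).
  have h0 : 0 <= modulus (F x) / rho by rewrite divr_ge0 ?modulus_ge0 // ltW.
  have t1 : 1 <= 1 + tau by lra.
  have := orlicz_dilation hM t1 h0.
  have -> : 1 + tau - 1 = tau by ring.
  have -> : modulus (F x) / rho / (1 + tau) = a x by rewrite -mulrA -invfM.
  have -> // : 2 * (modulus (F x) / rho) = modulus (F x) / (rho / 2).
  by field; rewrite gt_eqF.
have mid x : 2 * M (a x) <= M (p x) + M (q x).
  have h0 : 0 <= 2^-1 :> R by lra.
  have h1 : 2^-1 <= 1 :> R by lra.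
  have := orlicz_conv hM (p0 x) (q0 x) h0 h1.
  have := orlicz_le hM (a0 x) (_ : a x <= 2^-1 * p x + (1 - 2^-1) * q x).
  have apq' := apq x.
  move=> /(_ ltac:(lra)); lra.
have onE x : E x -> 2 * M (a x) + kap * modulus c ^+ 2 <= M (p x) + M (q x).
  move=> Ex; have [dF FB] := hF x Ex; have [dG GB] := hG x Ex.
  have cG : modulus c * modulus (G x) <= d / 2.
    apply: (@le_trans _ _ (d / (2 * B) * B)).
      by rewrite ler_pM ?modulus_ge0.
    by rewrite invfM mulrA divfK ?gt_eqF.
  have range (t : R) : d / 2 <= t -> t <= 2 * B ->
      t / l \in `[d / (4 * rho), 2 * B / rho].
    move=> t1 t2; rewrite in_itv /=; apply/andP; split.
      rewrite ler_pdivlMr // mulrAC ler_pdivrMr ?mulr_gt0 //; nra.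
    by rewrite ler_pdivrMr // mulrAC ler_pdivlMr //; nra.
  have Pu : modulus (P x) <= modulus (F x) + modulus c * modulus (G x).
    by rewrite -modulusM; exact: modulusD_le.
  have Qu : modulus (Q x) <= modulus (F x) + modulus c * modulus (G x).
    by rewrite QE -modulusM -(modulusN (c * _)); exact: modulusD_le.
  have Pl : modulus (F x) <= modulus (P x) + modulus c * modulus (G x).
    have {1}-> : F x = P x + - (c * G x) by rewrite /P addrK.
    by rewrite -modulusM -(modulusN (c * _)); exact: modulusD_le.
  have Ql : modulus (F x) <= modulus (Q x) + modulus c * modulus (G x).
    have {1}-> : F x = Q x + c * G x by rewrite QE subrK.
    by rewrite -modulusM; exact: modulusD_le.
  have h := hm _ _ _ _ (range (modulus (P x)) _ _) (range (modulus (Q x)) _ _)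
    (range (modulus (F x)) _ _) (apq x) (sq x).
  apply: le_trans (h _ _ _ _ _ _); try lra.
  rewrite lerD2l /kap.
  have -> : m * d ^+ 2 / (4 * rho ^+ 2) * modulus c ^+ 2 =
    m * (modulus c * d / (2 * rho)) ^+ 2 by field; rewrite gt_eqF.
  have lo0 : 0 <= modulus c * d / (2 * rho).
    by rewrite divr_ge0 ?mulr_ge0 ?modulus_ge0 ?(ltW d0) ?(ltW rho0).
  have hi0 : 0 <= modulus c * modulus (G x) / l.
    by apply: divr_ge0 (ltW l0); rewrite mulr_ge0 ?modulus_ge0.
  rewrite ler_wpM2l ?(ltW m0) // lerXn2r ?nnegrE //.
  apply: ler_pM.
  - by rewrite mulr_ge0 ?modulus_ge0 ?(ltW d0).
  - by rewrite invr_ge0; lra.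
  - by rewrite ler_wpM2l ?modulus_ge0.
  - by rewrite lef_pV2 ?posrE // mulr_gt0.
have mh f s : 0 < s -> scalar_measurable I01 f ->
    measurable_fun I01 (fun x => M (modulus (f x) / s)).
  by move=> s0 mf; apply: measurable_orlicz_modulus => //; exact: ltW.
have h0 f s x : 0 < s -> 0 <= M (modulus (f x) / s).
  by move=> s0; apply: (orlicz_modulus_ge0 hM); exact: ltW.
have : (\int[mu]_(x in I01) (2 * M (modulus (F x) / rho) +
      (kap * modulus c ^+ 2) * \1_E x)%:E <=
    \int[mu]_(x in I01) (1 * (1 * M (p x) + 1 * M (q x)) +
      (2 * tau) * M (modulus (F x) / (rho / 2)))%:E)%E.
  apply: le_integral_EFin => //.
  - apply: measurable_funD; apply: measurable_funM => //; exact: mh.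
  - apply: measurable_funD; apply: measurable_funM => //; last exact: mh.
    by apply: measurable_funD; apply: measurable_funM => //; exact: mh.
  - move=> x _; apply: addr_ge0; apply: mulr_ge0 => //; first exact: h0.
    by rewrite mulr_ge0 ?exprn_ge0 ?modulus_ge0.
  - move=> x Ix; rewrite !mul1r indicE; have := aM x.
    case: (boolP (x \in E)) => [/set_mem Ex|_].
      have := onE x Ex; rewrite mulr1; lra.
    have := mid x; rewrite mulr0; lra.
have Pge0 x : I01 x -> 0 <= 1 * M (p x) + 1 * M (q x).
  by move=> _; rewrite !mul1r addr_ge0 ?h0.
have iFE := @integral_linear2 R I01 (fun x => M (modulus (F x) / rho)) \1_E
  2 (kap * modulus c ^+ 2).
have iPQ := @integral_linear2 R I01 (fun x => M (p x)) (fun x => M (q x)) 1 1.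
have iR := @integral_linear2 R I01 (fun x => 1 * M (p x) + 1 * M (q x))
  (fun x => M (modulus (F x) / (rho / 2))) 1 (2 * tau).
rewrite iFE //; last 3 first.
- exact: mh.
- by move=> x _; exact: h0.
- by rewrite mulr_ge0 ?exprn_ge0 ?modulus_ge0.
rewrite iR //; last 4 first.
- by apply: measurable_funD; apply: measurable_funM => //; exact: mh.
- exact: mh.
- by move=> x _; exact: h0.
- by rewrite mulr_ge0.
rewrite iPQ //; last 4 first.
- exact: mh.
- exact: mh.
- by move=> x _; exact: h0.
- by move=> x _; exact: h0.
rewrite !mul1e integral_indic // (setIidl EI).
have Fnorm := modular_luxemburg_norm hM hD MF rho0 nF.
have CE : orlicz_modular M F (rho / 2) = (fine (orlicz_modular M F (rho / 2)))%:E.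
  rewrite fineK // ge0_fin_numE; first exact: modular_fin.
  by apply: (modular_ge0 hM); exact: ltW.
have muE : mu E = (fine (mu E))%:E.
  rewrite fineK // ge0_fin_numE ?measure_ge0 //.
  apply: (@le_lt_trans _ _ (mu I01)); last by rewrite mu_I01 ltry.
  by apply: le_measure; rewrite ?inE.
move: hP hQ Fnorm CE; rewrite /orlicz_modular -/(p _) -/(q _).
move=> hP hQ -> CE; set C := fine _ in CE *; rewrite CE => h.
have : (2%:E * 1 + (kap * modulus c ^+ 2)%:E * (fine (mu E))%:E <=
    1 + 1 + (2 * tau)%:E * C%:E)%E.
  by rewrite -muE; apply: (le_trans h); rewrite leeD // leeD.
rewrite -!EFinM -!EFinD lee_fin; lra.
Qed.


End NormEstimates.

(** * Isometries *)

Section Isometries.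
Context {R : realType} {k : scalar_kind} {M : R -> R}.
Local Notation K := (scalar_field R k).
Local Notation mu := (@lebesgue_measure R).
Local Notation I01 := (`[0, 1]%classic : set R).
Implicit Types (f g F G : R -> K) (l : R).
Hypothesis hM : orlicz_function M.
Hypothesis hM1 : twice_derivable_nneg M.
Hypothesis hD : Delta2 M.
Hypothesis hM2c : {within `[0, +oo[, continuous (derive_nneg (derive_nneg M))}.
Hypothesis hM20 : derive_nneg (derive_nneg M) 0 = 0.
Hypothesis hM2p : forall t : R, 0 < t -> 0 < derive_nneg (derive_nneg M) t.
Context {T : (R -> K) -> (R -> K)}.
Hypothesis hT : orlicz_isometry M T.

Lemma suppE f : supp f = I01 `&` [set x | 0 < modulus (f x)].
Proof.
apply/seteqP; split => x [Ix /= fx]; split => //=.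
  by rewrite lt_def modulus_ge0 modulus_eq0 fx.
by rewrite -modulus_eq0 gt_eqF.
Qed.

Lemma measurable_supp f : scalar_measurable I01 f -> measurable (supp f).
Proof.
move=> mf; rewrite suppE.
have mI : measurable I01 by exact: measurable_I01.
have := measurable_modulus mI mf mI (measurable_itv `]0, +oo[).
by congr measurable; apply/seteqP; split => x /=; rewrite !in_itv /= andbT.
Qed.

(** Linearity of T holds up to null sets only, which the modular does not
    see. *)
Lemma modular_isometry_comb f g (c : K) l : orlicz_space M f -> orlicz_space M g ->
  orlicz_space M (fun x => c * g x) -> orlicz_space M (fun x => f x + c * g x) ->
  0 <= l ->
  orlicz_modular M (fun x => T f x + c * T g x) l =
  orlicz_modular M (T (fun x => f x + c * g x)) l.
Proof.
move=> Mf Mg Mcg Mfcg l0; have [TM _ TD TZ _] := hT.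
have [mTf _] := TM _ Mf; have [mTg _] := TM _ Mg; have [mT _] := TM _ Mfcg.
apply: modular_ae_eq => //.
  by apply: scalar_measurableD => //; exact: scalar_measurableZ.
apply: filterS2 (TD _ _ Mf Mcg) (TZ c _ Mg) => x h1 h2 Ix.
by rewrite h1 // h2.
Qed.

Lemma bounded_orlicz_space g (B : R) : scalar_measurable I01 g ->
  (forall x, I01 x -> modulus (g x) <= B) -> orlicz_space M g.
Proof.
move=> mg gB; split => //.
have B0 : 0 <= B.
  by apply: le_trans (gB 0 _); rewrite ?modulus_ge0 //= in_itv /= lexx ler01.
have B1 : 0 < B + 1 by lra.
apply: (@le_lt_trans _ _ (B + 1)%:E); last exact: ltry.
apply: luxemburg_norm_le => //.
have <- : (\int[mu]_(x in I01) 1%:E = 1)%E.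
  by rewrite (integral_cst mu (@measurable_I01 R) 1%E) mul1e; exact: mu_I01.
apply: (@le_integral_EFin _ _ _ (fun=> 1)) => //.
- by apply: measurable_orlicz_modulus => //; exact: ltW.
- by move=> x _; apply: (orlicz_modulus_ge0 hM); exact: ltW.
- move=> x Ix; have [_ _ [_ M1] _ _] := hM; rewrite -[leRHS]M1.
  apply: (orlicz_le hM); first by rewrite divr_ge0 ?modulus_ge0 // ltW.
  by rewrite ler_pdivrMr // mul1r; have := gB x Ix; lra.
Qed.

(** The heart of the argument: the upper bound for f + c g and the lower bound
    for T f + c T g have different orders in |c|. *)
Lemma disjoint_of_bounded f g (B : R) : orlicz_space M f -> scalar_measurable I01 g ->
  (forall x, I01 x -> f x = 0 \/ g x = 0) ->
  (forall x, I01 x -> modulus (g x) <= B) ->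
  mu (supp (T f) `&` supp (T g)) = 0%E.
Proof.
move=> Mf mg fg gB'.
(* B may be 0. *)
pose B1 := Num.max B 1.
have B10 : 0 < B1 by rewrite lt_max ltr01 orbT.
have gB x : I01 x -> modulus (g x) <= B1.
  by move=> Ix; rewrite le_max gB'.
have Mg := bounded_orlicz_space mg gB.
have mI : measurable I01 by exact: measurable_I01.
have [TM Tae TD TZ Tn] := hT.
have MF := TM _ Mf; have MG := TM _ Mg.
have [mF _] := MF; have [mG _] := MG.
have msF := measurable_supp mF; have msG := measurable_supp mG.
have nfin : luxemburg_norm M f = (fine (luxemburg_norm M f))%:E.
  by rewrite fineK // ge0_fin_numE ?luxemburg_norm_ge0 //; case: Mf.
set rho := fine _ in nfin.
have : 0 <= rho by rewrite fine_ge0 // luxemburg_norm_ge0.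
rewrite le_eqVlt => /orP[/eqP rho0|rho0].
  apply: (@subset_measure0 _ _ _ mu _ (I01 `&` supp (T f))).
  - exact: measurableI.
  - exact: measurableI.
  - by move=> x [[Ix fx] _].
  - apply: (null_of_modular hM) => // l l0.
    by apply: (modular_le1 hM mF); rewrite Tn // nfin -rho0 lte_fin.
pose h x := Num.min (modulus (T f x)) (modulus (T g x)).
pose H x := Num.max (modulus (T f x)) (modulus (T g x)).
have mmF := measurable_modulus mI mF; have mmG := measurable_modulus mI mG.
have mh : measurable_fun I01 h by exact: measurable_minr.
have mH : measurable_fun I01 H by exact: measurable_maxr.
have -> : supp (T f) `&` supp (T g) = I01 `&` [set x | 0 < h x].
  rewrite !suppE /h; apply/seteqP; split => x /=; rewrite lt_min.
    by move=> [[Ix ->] [_ ->]].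
  by move=> [Ix /andP[]].
apply: null_of_level_sets => // d d0.
set L := I01 `&` _.
have mL : measurable L.
  have := mh mI _ (measurable_itv `[d, +oo[).
  by congr measurable; apply/seteqP; split => x /=; rewrite !in_itv /= andbT.
(* An upper bound on both moduli is gained by exhausting L. *)
pose E n := L `&` [set x | H x <= n%:R].
have mE n : measurable (E n).
  have -> : E n = L `&` (I01 `&` H @^-1` `]-oo, n%:R]).
    apply/seteqP; split => x /=; rewrite !in_itv /=.
      by move=> [[Ix ?] ?]; split.
    by move=> [[Ix ?] [_ ?]].
  by apply: measurableI => //; exact: (mH mI _ (measurable_itv _)).
have EI n : E n `<=` I01 by move=> x [[]].
suff E0 n : mu (E n) = 0%E.
  have negE : mu.-negligible (\bigcup_n E n).
    by apply: negligible_bigcup => n; apply/negligibleP; [exact: mE|exact: E0].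
  apply: measure_negligible; first exact: mL.
  apply: negligibleS negE => x Lx.
  exists (Num.bound (H x)) => //; split => //=; apply/ltW/archi_boundP.
  by rewrite le_max modulus_ge0.
have nF : luxemburg_norm M (T f) = rho%:E by rewrite Tn.
have dB : d <= Num.max d n%:R by rewrite le_max lexx.
have FE x : E n x -> d <= modulus (T f x) /\ modulus (T f x) <= Num.max d n%:R.
  move=> [[_ /=]]; rewrite /h /H le_min ge_max => /andP[-> _] /andP[Fn _].
  by rewrite le_max Fn orbT.
have GE x : E n x -> d <= modulus (T g x) /\ modulus (T g x) <= Num.max d n%:R.
  move=> [[_ /=]]; rewrite /h /H le_min ge_max => /andP[_ ->] /andP[_ Gn].
  by rewrite le_max Gn orbT.
have [a0 [kap [C [a00 kap0 C0 est]]]] := curvature_estimate hM hD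
  (orlicz_midpoint_curved hM hM1 hM2c hM2p) MF mG rho0 nF (mE n) (@EI n) d0 dB FE GE.
have muE : mu (E n) = (fine (mu (E n)))%:E.
  rewrite fineK // ge0_fin_numE ?measure_ge0 //.
  apply: (@le_lt_trans _ _ (mu I01)); last by rewrite mu_I01 ltry.
  by apply: le_measure; [exact: mem_set (mE n)|exact: mem_set|exact: EI].
have e0 : 0 <= fine (mu (E n)) by rewrite fine_ge0.
rewrite muE; apply/eqP; rewrite eqe; apply/contraT => en0.
move: est; set e := fine _ in e0 en0 * => est.
have e_gt0 : 0 < e by rewrite lt_def en0.
(* Any positive mass e of E n is contradicted by tau = eta |c|^2, where eta is
   chosen with eta C < kap e, once |c| is so small that M (|c| B / rho) is below
   tau. *)
pose eta := kap * e / (2 * (C + 1)).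
have C1 : 0 < C + 1 by lra.
have eta0 : 0 < eta by rewrite divr_gt0 ?mulr_gt0.
have eps0 : 0 < eta * rho ^+ 2 / (2 * B1 ^+ 2).
  by apply: divr_gt0; apply: mulr_gt0 => //; exact: exprn_gt0.
have [del del0 hdel] := orlicz_littleo_sqr hM hM1 hM20 eps0.
pose al := Num.min a0 (Num.min (del * rho / (2 * B1)) (1 + eta)^-1).
have al0 : 0 < al.
  rewrite !lt_min a00 /= divr_gt0 ?mulr_gt0 //= invr_gt0; lra.
have al_a0 : al <= a0 by rewrite ge_min lexx.
have al_del : al <= del * rho / (2 * B1) by rewrite !ge_min lexx /= orbT.
have al_eta : al * (1 + eta) <= 1.
  rewrite -ler_pdivlMr ?mul1r; last lra.
  by rewrite !ge_min lexx !orbT.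
pose tau := eta * al ^+ 2.
have tau0 : 0 < tau by rewrite mulr_gt0 // exprn_gt0.
have tau1 : tau <= 1.
  have ae0 : 0 < al * eta by rewrite mulr_gt0.
  have al1 : al <= 1 by lra.
  rewrite /tau expr2 mulrA [eta * al]mulrC.
  by apply: (@le_trans _ _ (al * eta)); [rewrite ler_piMr // ltW|lra].
have Mu : M (al * B1 / rho) < tau.
  have u0 : 0 < al * B1 / rho by rewrite divr_gt0 // mulr_gt0.
  have ud : al * B1 / rho < del.
    rewrite ltr_pdivrMr //.
    have : al * (2 * B1) <= del * rho by rewrite -ler_pdivlMr // mulr_gt0.
    have : 0 < al * B1 by rewrite mulr_gt0.
    lra.
  apply: le_lt_trans (hdel _ u0 ud) _.
  have -> : eta * rho ^+ 2 / (2 * B1 ^+ 2) * (al * B1 / rho) ^+ 2 = tau / 2.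
    by rewrite /tau; field; rewrite !gt_eqF.
  lra.
have [c cal] := @modulus_onto R k al (ltW al0).
have key (c' : K) : modulus c' = al ->
    (orlicz_modular M (fun x => T f x + c' * T g x)%R (rho * (1 + tau)) <= 1)%E.
  move=> c'al.
  have l0 : 0 <= rho * (1 + tau) by rewrite mulr_ge0 // ?ltW //; lra.
  have cgB x : I01 x -> modulus (c' * g x) <= al * B1.
    by move=> Ix; rewrite modulusM c'al ler_wpM2l ?(ltW al0) // gB.
  have Mcg : orlicz_space M (fun x => c' * g x).
    by apply: bounded_orlicz_space cgB; exact: scalar_measurableZ.
  have nle := norm_disjoint_perturbation hM hD c' Mf mg rho0 nfin fg gB.
  have Mfcg : orlicz_space M (fun x => f x + c' * g x).
    split; last by apply: le_lt_trans nle (ltry _).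
    by apply: scalar_measurableD => //; [case: Mf|case: Mcg].
  rewrite modular_isometry_comb //.
  have [mT _] := TM _ Mfcg.
  apply: (modular_le1 hM mT); rewrite Tn //.
  apply: le_lt_trans nle _.
  by rewrite lte_fin ltr_pM2l // ltrD2l c'al.
have := est c tau; rewrite cal => /(_ al_a0 (ltW tau0) tau1 (key c cal)).
have cN : modulus (- c) = al by rewrite modulusN.
move=> /(_ (key _ cN)).
have -> : kap * al ^+ 2 * e = (kap * e) * al ^+ 2 by ring.
have -> : tau * C = eta * C * al ^+ 2 by rewrite /tau; ring.
rewrite ler_pM2r ?exprn_gt0 // => final.
have : eta * (2 * (C + 1)) = kap * e by rewrite /eta divfK // gt_eqF // mulr_gt0.
have : 0 < kap * e by rewrite mulr_gt0.
have : 0 <= eta * C by rewrite mulr_ge0 // ltW.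
lra.
Qed.


(** Delta_2 makes M (|g| / l) integrable, so the tails vanish by dominated
    convergence. *)
Lemma modular_tail_le1 g l : orlicz_space M g -> 0 < l ->
  exists n : nat,
   (orlicz_modular M (fun x => if (n%:R < modulus (g x))%R then g x else 0%R) l <= 1)%E.
Proof.
move=> Mg l0; have [mg _] := Mg.
have mI : measurable I01 by exact: measurable_I01.
pose h n x := if (n%:R < modulus (g x))%R then g x else 0.
have mhn n : scalar_measurable I01 (h n).
  apply: scalar_measurable_if => //.
  by apply: measurable_fun_ltr => //; exact: measurable_modulus.
have [] := @dominated_convergence _ _ _ mu I01 mI
  (fun n x => (M (modulus (h n x) / l))%:E) (cst 0%E)
  (fun x => (M (modulus (g x) / l))%:E).
- move=> n; apply/measurable_EFinP; apply: measurable_orlicz_modulus => //; exact: ltW.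
- exact: measurable_cst.
- apply/nearW => x Ix; apply: cvg_near_cst.
  exists (Num.bound (modulus (g x))) => // n /= ng.
  rewrite /h ltNge (_ : modulus (g x) <= n%:R) /=.
    by rewrite modulus0 mul0r (orlicz0 hM).
  apply: ltW; apply: lt_le_trans (archi_boundP (modulus_ge0 _)) _.
  by rewrite ler_nat.
- apply/integrableP; split.
    by apply/measurable_EFinP; apply: measurable_orlicz_modulus => //; exact: ltW.
  rewrite (_ : (\int[mu]_(x in I01) _)%E = orlicz_modular M g l); first exact: modular_fin.
  apply: eq_integral => x _; rewrite gee0_abs // lee_fin.
  by apply: (orlicz_modulus_ge0 hM); exact: ltW.
- apply/nearW => x Ix n; rewrite gee0_abs ?lee_fin; last first.
    by apply: (orlicz_modulus_ge0 hM); exact: ltW.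
  apply: (orlicz_le hM); first by rewrite divr_ge0 ?modulus_ge0 // ltW.
  rewrite ler_wpM2r ?invr_ge0 ?(ltW l0) //.
  by rewrite /h; case: ifP => // _; rewrite modulus0 modulus_ge0.
move=> _ _; rewrite integral0 => /fine_cvgP[hfin hlim].
have hl := (cvgr0Pnorm_lt _).1 hlim 1 ltr01.
have [n [/= fin_n lt_n]] := filter_ex (filterI hfin (hl _)).
exists n; rewrite /orlicz_modular -(fineK fin_n) lee_fin.
exact: ltW (le_lt_trans (ler_norm _) lt_n).
Qed.

(** The bounded part b of g has an image disjoint from T f, so T g agrees with
    the small function T (g - b) on the support of T f. *)
Lemma disjoint_of_pointwise f g : orlicz_space M f -> orlicz_space M g ->
  (forall x, I01 x -> f x = 0 \/ g x = 0) ->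
  mu (supp (T f) `&` supp (T g)) = 0%E.
Proof.
move=> Mf Mg fg; have [mf _] := Mf; have [mg _] := Mg.
have mI : measurable I01 by exact: measurable_I01.
have [TM Tae TD TZ Tn] := hT.
have [mF _] := TM _ Mf; have [mG _] := TM _ Mg.
have msF := measurable_supp mF.
have FI : supp (T f) `<=` I01 by move=> x [].
apply: (null_of_modular hM) => // l l0.
have l20 : 0 < l / 2 by rewrite divr_gt0.
have [n hn] := modular_tail_le1 Mg l20.
pose h x := if (n%:R < modulus (g x))%R then g x else 0.
pose b x := if (modulus (g x) <= n%:R)%R then g x else 0.
have mmg := measurable_modulus mI mg.
have mh : scalar_measurable I01 h.
  by apply: scalar_measurable_if => //; exact: measurable_fun_ltr.
have mb : scalar_measurable I01 b.
  by apply: scalar_measurable_if => //; exact: measurable_fun_ler.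
have Mh : orlicz_space M h.
  apply: orlicz_space_le_modulus Mg mh _ => // x _.
  by rewrite /h; case: ifP => // _; rewrite modulus0 modulus_ge0.
have Mb : orlicz_space M b.
  apply: orlicz_space_le_modulus Mg mb _ => // x _.
  by rewrite /b; case: ifP => // _; rewrite modulus0 modulus_ge0.
have gE : g = (fun x => b x + h x).
  apply/funext => x; rewrite /b /h leNgt; case: ltP => _ /=.
    by rewrite add0r.
  by rewrite addr0.
have bF : mu (supp (T f) `&` supp (T b)) = 0%E.
  apply: (@disjoint_of_bounded f b n%:R) => // x Ix.
    by rewrite /b; case: (fg x Ix) => ->; [left|right; case: ifP].
  by rewrite /b; case: ifP => // _; rewrite modulus0.
have [mTh _] := TM _ Mh; have [mTb _] := TM _ Mb.
have nTh : (luxemburg_norm M (T h) < l%:E)%E.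
  rewrite Tn //; apply: (@le_lt_trans _ _ (l / 2)%:E).
    exact: luxemburg_norm_le.
  by rewrite lte_fin ltr_pdivrMr // ltr_pMr // ltr1n.
apply: le_trans (modular_le1 hM mTh nTh).
rewrite (@ge0_ae_eq_integral _ _ _ mu (supp (T f)) _
  (fun x => (M (modulus (T h x) / l))%:E)) //.
- apply: ge0_subset_integral => //.
  + by apply/measurable_EFinP; apply: measurable_orlicz_modulus => //; exact: ltW.
  + by move=> x _; rewrite lee_fin; apply: (orlicz_modulus_ge0 hM); exact: ltW.
- apply: (@measurable_funS _ _ _ _ I01) => //.
  by apply/measurable_EFinP; apply: measurable_orlicz_modulus => //; exact: ltW.
- apply: (@measurable_funS _ _ _ _ I01) => //.
  by apply/measurable_EFinP; apply: measurable_orlicz_modulus => //; exact: ltW.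
- by move=> x _; rewrite lee_fin; apply: (orlicz_modulus_ge0 hM); exact: ltW.
- by move=> x _; rewrite lee_fin; apply: (orlicz_modulus_ge0 hM); exact: ltW.
have nb : ae_eq mu (supp (T f)) (T b) (fun=> 0).
  have ms : measurable (supp (T f) `&` supp (T b)).
    by apply: measurableI => //; exact: measurable_supp.
  exists (supp (T f) `&` supp (T b)); split => // x /= /not_implyP[Fx bx].
  by split => //; split; [exact: FI|exact/eqP].
have := TD _ _ Mb Mh; rewrite -gE => hTD.
apply: filterS2 nb hTD => x hb hx Fx.
rewrite hx ?hb //; last exact: FI.
by rewrite add0r.
Qed.

Lemma isometry_preserves_disjointness : preserves_disjointness M T.
Proof.
move=> f g Mf Mg fg0; have [mf _] := Mf; have [mg _] := Mg.
have mI : measurable I01 by exact: measurable_I01.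
have [TM Tae TD TZ Tn] := hT.
(* g' vanishes where f does not, and differs from g on a null set only. *)
pose g' x := if modulus (f x) <= 0 then g x else 0.
have mg' : scalar_measurable I01 g'.
  apply: scalar_measurable_if => //.
  by apply: measurable_fun_ler => //; exact: measurable_modulus.
have Mg' : orlicz_space M g'.
  apply: orlicz_space_le_modulus Mg mg' _ => // x _.
  by rewrite /g'; case: ifP => // _; rewrite modulus0 modulus_ge0.
have gg' : ae_eq mu I01 g g'.
  have ms : measurable (supp f `&` supp g).
    by apply: measurableI; exact: measurable_supp.
  exists (supp f `&` supp g); split => // x /= /not_implyP[Ix].
  rewrite /g' leNgt; case: ltP => //= fx gx.
  split; split => //; last exact/eqP.
  by rewrite -modulus_eq0 gt_eqF.
have h0 := disjoint_of_pointwise Mf Mg' _.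
have [mF _] := TM _ Mf; have [mG _] := TM _ Mg; have [mG' _] := TM _ Mg'.
have h0' : mu (supp (T f) `&` supp (T g')) = 0%E.
  apply: h0 => x _; rewrite /g'; case: ifP => [fx|]; last by right.
  by left; apply/eqP; rewrite -modulus_eq0 eq_le fx modulus_ge0.
have ms : measurable (supp (T f) `&` supp (T g)).
  by apply: measurableI; exact: measurable_supp.
have ms' : measurable (supp (T f) `&` supp (T g')).
  by apply: measurableI; exact: measurable_supp.
apply: measure_negligible; first exact: ms.
have [N [mN N0 NP]] := Tae _ _ Mg Mg' gg'.
have negN : mu.-negligible N by exists N; split.
have negS : mu.-negligible (supp (T f) `&` supp (T g')) by apply/negligibleP.
apply: negligibleS (negligibleU negS negN).
move=> x [[Ix fx] [_ gx]].
have [e|ne] := eqVneq (T g x) (T g' x).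
  by left; split; split => //; rewrite -e.
by right; apply: NP => /= /(_ Ix) e; rewrite e eqxx in ne.
Qed.

End Isometries.

Theorem theorem3p2 (R : realType) (k : scalar_kind) (M : R -> R)
    (hM : orlicz_function M)
    (hMD : Delta2plus M)
    (hM2c : {within `[0, +oo[, continuous (derive_nneg (derive_nneg M))})
    (hM20 : derive_nneg (derive_nneg M) 0 = 0)
    (hM2p : forall t : R, 0 < t -> 0 < derive_nneg (derive_nneg M) t)
    (T : (R -> scalar_field R k) -> (R -> scalar_field R k))
    (hT : orlicz_isometry M T) :
  preserves_disjointness M T.
Proof.
have [hM1 hD _] := hMD.
exact: (isometry_preserves_disjointness hM hM1 hD hM2c hM20 hM2p hT).
Qed.
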